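(* Let $\lambda_i,\lambda_{i,1},\lambda_{i,2}$ ($i=1,\dots,r$) be the components of the generalized functional invariants of the mirrors of $X$, $X_1$ and $\tilde X_2$ respectively, as defined in the context: $$\lambda_i=\frac{q_i}{\prod_{k=1}^a(1-y)^{m_{ij_k}}\prod_{k=a+1}^{a+b}y^{m_{ij_k}}},\qquad \lambda_{i,1}=\frac{q_{i,1}}{\prod_{k=a+1}^{a+b}y_1^{m_{ij_k}}},\qquad \lambda_{i,2}=\frac{q_{i,2}}{y_2^{-\sum_{k=a+1}^{a+b}m_{ij_k}}\prod_{k=1}^a(1-q_{0,2}/y_2)^{m_{ij_k}}}.$$ Under the identification of variables $$q_i=q_{i,1}=q_{i,2}\,y_2^{\sum_{k=a+1}^{a+b}m_{ij_k}}\ (i=1,\dots,r),\qquad y=y_1=q_{0,2}/y_2,$$ the generalized functional invariants satisfy the product relation $$\frac{\lambda_i}{q_i}=\frac{\lambda_{i,1}}{q_i}\cdot\frac{\lambda_{i,2}}{q_i},\qquad i=1,\dots,r.$$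
   Context: $Y$ is a toric variety with toric divisor classes $D_j=\sum_{i=1}^r m_{ij}p_i$ ($1\le j\le m$), where $p_1,\dots,p_r$ is a nef integral basis of $H^2(Y,\mathbb Z)$. $X\subset Y$ is a Calabi-Yau complete intersection defined by a generic section of $L_0\oplus\cdots\oplus L_s$, corresponding to a nef partition of the toric divisors into $s+1$ groups; $F_l(x)$ denotes the sum of the variables $x_j$ in group $l$. The group $l=0$ is split (refinement $L_0=L_{0,1}\otimes L_{0,2}$ into nef line bundles) into $F_{0,1}(x)=x_{j_1}+\dots+x_{j_a}$ and $F_{0,2}(x)=x_{j_{a+1}}+\dots+x_{j_{a+b}}$. $X_1$, $X_2$ are the quasi-Fano complete intersections for $L_{0,1}\oplus L_1\oplus\cdots\oplus L_s$ and $L_{0,2}\oplus L_1\oplus\cdots\oplus L_s$; $\tilde X_2$ is the blow-up of $X_2$ along $X_2\cap\{s_0=0\}\cap\{s_{0,1}=0\}$ ($s_0,s_{0,1}$ generic sections of $L_0,L_{0,1}$); $X_0=X_1\cap\tilde X_2$ is the Calabi-Yau complete intersection for $L_{0,1}\oplus L_{0,2}\oplus L_1\oplus\cdots\oplus L_s$. The mirrors are (fiberwise) compactifications of: - $X^\vee$: $\{x\in(\mathbb C^* )^m:\prod_jx_j^{m_{ij}}=q_i\ (i=1,\dots,r),\ F_l(x)=1\ (l=0,\dots,s)\}$, fibered by $y=F_{0,2}(x)$; - $X_1^\vee$: $\{x\in(\mathbb C^* )^m:\prod_jx_j^{m_{ij}}=q_{i,1},\ F_l(x)=1\ (l=1,\dots,s),\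 F_{0,1}(x)=1\}$ with superpotential $y_1=F_{0,2}(x)$; - $\tilde X_2^\vee$: $\{(x,y_2)\in(\mathbb C^* )^{m+1}:(\prod_jx_j^{m_{ij}})y_2^{-\sum_{k=a+1}^{a+b}m_{ij_k}}=q_{i,2},\ F_l(x)=1\ (l=1,\dots,s),\ F_{0,1}(x)+q_{0,2}/y_2=1,\ F_{0,2}(x)=1\}$ with superpotential $y_2$; - $X_0^\vee$ (with parameters $q_i$): $\{x\in(\mathbb C^* )^m:\prod_jx_j^{m_{ij}}=q_i,\ F_l(x)=1\ (l=1,\dots,s),\ F_{0,1}(x)=F_{0,2}(x)=1\}$. The generalized functional invariant of each of the first three families is the tuple of rational functions giving, for each fiber, the parameters $(q_1,\dots,q_r)$ of the member of the family $X_0^\vee$ to which the fiber is isomorphic after rescaling the variables $x_{j_k}$ so that $F_{0,1}=F_{0,2}=1$; it is given by the formulas in the claim. *)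

(* Defs.v *)
From HB Require Import structures.
From mathcomp Require Import all_boot all_order all_algebra.
From mathcomp Require Import classical_sets functions reals.
From mathcomp Require Export complex.

Set Implicit Arguments.
Unset Strict Implicit.
Unset Printing Implicit Defensive.

Import Order.TTheory GRing.Theory Num.Theory.
Local Open Scope ring_scope.

(* The toric variety Y is given by its fan in N = Z^n.  As every toric divisor
   class is an integral combination of a basis of H^2(Y, Z) = Pic(Y), every
   toric divisor is Cartier, which forces the fan to be smooth. *)

Section Fan.
Variables n m : nat.

Definition rat_row (u : 'rV[int]_n) : 'rV[rat]_n := map_mx intr u.

(* Rational points suffice: the cones involved are rational. *)
Definition in_cone (v : 'M[int]_(m, n)) (S : {set 'I_m}) (u : 'rV[rat]_n) :=
  exists c : 'I_m -> rat,
    (forall j, 0 <= c j) /\ u = \sum_(j in S) c j *: rat_row (row j v).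

(* A maximal cone is encoded by the set of (indices of) its rays; n vectors
   that generate Z^n over Z form a basis. *)
Record smooth_complete_fan := SmoothCompleteFan {
  ray : 'M[int]_(m, n);
  max_cone : {set {set 'I_m}};
  max_cone_card : forall S, S \in max_cone -> #|S| = n;
  max_cone_basis : forall S, S \in max_cone -> forall u : 'rV[int]_n,
    exists c : 'I_m -> int, u = \sum_(j in S) c j *: row j ray;
  cone_meet : forall S T, S \in max_cone -> T \in max_cone -> forall u,
    in_cone ray S u -> in_cone ray T u -> in_cone ray (S :&: T) u;
  fan_complete : forall u, exists2 S, S \in max_cone & in_cone ray S u;
  ray_in_fan : forall j, exists2 S, S \in max_cone & j \in S
}.

Variable Y : smooth_complete_fan.

(* Torus-invariant divisors are identified with Z^m, the j-th basis vector
   being the prime divisor D_j attached to the j-th ray. *)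
Definition tdiv (j : 'I_m) : 'rV[int]_m := delta_mx 0 j.

(* The divisor of the character u is \sum_j <u, v_j> D_j. *)
Definition char_div (u : 'rV[int]_n) : 'rV[int]_m := u *m (ray Y)^T.

Definition lin_equiv (d e : 'rV[int]_m) := exists u, d - e = char_div u.

(* Each local datum u_S of d lies in the polytope
   {u | <u, v_j> >= - d_j for all j}. *)
Definition nef (d : 'rV[int]_m) :=
  forall S, S \in max_cone Y -> exists u,
    (forall j, j \in S -> char_div u 0 j = - d 0 j) /\
    (forall j, - d 0 j <= char_div u 0 j).

(* The rows of p represent p_1, ..., p_r; H^2(Y, Z) is the group of
   torus-invariant divisors modulo linear equivalence. *)
Definition nef_integral_basis r (p : 'M[int]_(r, m)) :=
  (forall i, nef (row i p)) /\
  (forall d : 'rV[int]_m, exists! b : 'rV[int]_r, lin_equiv d (b *m p)).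

Definition sum_div (G : {set 'I_m}) : 'rV[int]_m := \sum_(j in G) tdiv j.

Definition nef_part (G : {set 'I_m}) := (0 < #|G|)%N /\ nef (sum_div G).

End Fan.

(* The combinatorial data: D_j = \sum_i mult i j p_i, the nef partition into the
   s.+1 groups [group l], with L_l = O(sum_div (group l)), and the refinement
   of group 0 into group01, for L_{0,1}, and group02, for L_{0,2}. *)
Record split_nef_data (n m r s : nat) := SplitNefData {
  fan : smooth_complete_fan n m;
  nef_basis : 'M[int]_(r, m);
  mult : 'M[int]_(r, m);
  part : 'I_m -> 'I_s.+1;
  group01 : {set 'I_m};
  group02 : {set 'I_m};
  group : 'I_s.+1 -> {set 'I_m} := fun l => [set j | part j == l]%SET;
  basisP : nef_integral_basis fan nef_basis;
  divisor_class : forall j,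
    lin_equiv fan (tdiv j) (\sum_i mult i j *: row i nef_basis);
  group_nef : forall l : 'I_s.+1, nef_part fan (group l);
  split_cover : (group01 :|: group02)%SET = group ord0;
  split_disjoint : [disjoint group01 & group02];
  nef01 : nef_part fan group01;
  nef02 : nef_part fan group02
}.

Local Open Scope classical_set_scope.
Local Open Scope ring_scope.

Section Mirrors.
Variables (R : realType) (n m r s : nat) (d : split_nef_data n m r s).
Local Notation C := R[i].
Implicit Types (q : 'I_r -> C) (x : 'rV[C]_m).

Definition in_torus x := forall j, x 0 j != 0.

Definition monomial x (i : 'I_r) : C := \prod_j x 0 j ^ mult d i j.

Definition F (G : {set 'I_m}) x : C := \sum_(j in G) x 0 j.

Definition X_mirror q : set 'rV[C]_m :=
  [set x | [/\ in_torus x, forall i, monomial x i = q i &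
               forall l : 'I_s.+1, F (group d l) x = 1]].

Definition X1_mirror q : set 'rV[C]_m :=
  [set x | [/\ in_torus x, forall i, monomial x i = q i,
               forall l : 'I_s.+1, l != ord0 -> F (group d l) x = 1 & F (group01 d) x = 1]].

(* The second component of a point is the coordinate y_2. *)
Definition X2_mirror q (q02 : C) : set ('rV[C]_m * C) :=
  [set z | [/\ in_torus z.1 /\ z.2 != 0,
     forall i, monomial z.1 i * z.2 ^ (- \sum_(k in group02 d) mult d i k) = q i,
     forall l : 'I_s.+1, l != ord0 -> F (group d l) z.1 = 1,
     F (group01 d) z.1 + q02 / z.2 = 1 & F (group02 d) z.1 = 1]].

Definition X0_mirror q : set 'rV[C]_m :=
  [set x | [/\ in_torus x, forall i, monomial x i = q i,
               forall l : 'I_s.+1, l != ord0 -> F (group d l) x = 1,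
               F (group01 d) x = 1 & F (group02 d) x = 1]].

Definition rescale x : 'rV[C]_m :=
  \row_j (if j \in group01 d then x 0 j / F (group01 d) x
          else if j \in group02 d then x 0 j / F (group02 d) x
          else x 0 j).

Definition rational_on (U : set C) (f : C -> C) :=
  exists p e : {poly C}, forall t, U t -> e.[t] != 0 /\ f t = p.[t] / e.[t].

(* [lam] is the generalized functional invariant of the family W : E -> C:
   rational functions such that, for every t in U, the fibre W = t is carried
   isomorphically by the rescaling to the member of the family X0_mirror with
   parameters lam t.  Points of E are seen in (C^* )^m through [coord]. *)
Definition functional_invariant (P : Type) (E : set P) (W : P -> C)
    (coord : P -> 'rV[C]_m) (U : set C) (lam : C -> 'I_r -> C) :=
  (forall i, rational_on U (lam ^~ i)) /\
  (forall t, U t -> (forall i, lam t i != 0) /\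
     set_bij (E `&` W @^-1` [set t]) (X0_mirror (lam t)) (rescale \o coord)).

(* The bases below consist of the values of the superpotential for which
   neither F_{0,1} nor F_{0,2} vanishes on the fibre. *)
Definition X_base : set C := [set y | y != 0 /\ y != 1].
Definition X1_base : set C := [set y1 | y1 != 0].
Definition X2_base (q02 : C) : set C := [set y2 | y2 != 0 /\ y2 != q02].

Definition lambda q (y : C) (i : 'I_r) : C :=
  q i / ((\prod_(k in group01 d) (1 - y) ^ mult d i k) * \prod_(k in group02 d) y ^ mult d i k).

Definition lambda1 q (y1 : C) (i : 'I_r) : C :=
  q i / \prod_(k in group02 d) y1 ^ mult d i k.

Definition lambda2 q (q02 y2 : C) (i : 'I_r) : C :=
  q i / (y2 ^ (- \sum_(k in group02 d) mult d i k) *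
         \prod_(k in group01 d) (1 - q02 / y2) ^ mult d i k).

End Mirrors.

(* Main.v *)
Require Import Defs.
From mathcomp Require Import all_boot all_order all_algebra.
From mathcomp Require Import boolp classical_sets functions reals complex.

(** On a fibre of each of the three families the two partial sums F_{0,1} and
    F_{0,2} are constant, say equal to [a] and [b], both nonzero over the chosen
    base; every other condition on the point is a monomial equation or concerns
    a group [l != 0].  For X the values are [a = 1 - y] and [b = y], since
    F_{0,1} + F_{0,2} = F_0 = 1; for X_1 they are [1] and [y1]; for the blow-up
    of X_2 they are [1 - q02 / y2] and [1].

    So all three fibres are instances of one set, [split_fibre d c a b], and the
    mirror of X_0 with parameters [c] is [split_fibre d c 1 1].  The pairs
    [(a, b)] of nonzero numbers act on the points by multiplying the coordinates
    of the two subgroups by [a] and [b] ([scale_split]).  The action multiplies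
    F_{0,1} by [a], F_{0,2} by [b], fixes the other F_l, and multiplies the i-th
    monomial by the character [weight d a b i] of the action.  On a fibre
    [rescale] is the action of [(a^-1, b^-1)], hence it is a bijection onto the
    mirror of X_0 with parameters [c i / weight d a b i]
    ([rescale_split_fibre]).  With the values of [a] and [b] above these
    parameters are the three functional invariants.

    The product relation is then the multiplicativity of the weight: when
    [y = y1 = q02 / y2], the weight of [(1 - y, y)] is that of [(1, y)] times
    that of [(1 - y, 1)], and the relation between [q] and [q2] absorbs the
    power of [y2] in the third invariant. *)

Set Implicit Arguments.
Unset Strict Implicit.
Unset Printing Implicit Defensive.

Import Order.TTheory GRing.Theory Num.Theory.
Local Open Scope ring_scope.

(** * Rational functions on a subset of the complex numbers *)

Section RationalOn.
Variables (R : realType) (U : set R[i]).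
Implicit Types f g : R[i] -> R[i].

Lemma eq_rational_on f g :
  (forall t, U t -> f t = g t) -> rational_on U f -> rational_on U g.
Proof.
move=> fg [p [e pe]]; exists p, e => t Ut.
by rewrite -fg //; exact: pe.
Qed.

Lemma rational_on_horner (p : {poly R[i]}) : rational_on U (horner p).
Proof. by exists p, 1 => t _; rewrite hornerC oner_neq0 divr1. Qed.

Lemma rational_on_cst c : rational_on U (fun=> c).
Proof.
by apply: eq_rational_on (rational_on_horner c%:P) => t _; rewrite hornerC.
Qed.

Lemma rational_on_id : rational_on U id.
Proof. by apply: eq_rational_on (rational_on_horner 'X) => t _; rewrite hornerX. Qed.

Lemma rational_onB f g :
  rational_on U f -> rational_on U g -> rational_on U (fun t => f t - g t).
Proof.
move=> [p [e pe]] [p' [e' pe']]; exists (p * e' - p' * e), (e * e') => t Ut.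
have [e0 ->] := pe t Ut; have [e'0 ->] := pe' t Ut.
by rewrite !hornerE mulf_neq0 // -mulNr addf_div // mulNr.
Qed.

Lemma rational_onM f g :
  rational_on U f -> rational_on U g -> rational_on U (fun t => f t * g t).
Proof.
move=> [p [e pe]] [p' [e' pe']]; exists (p * p'), (e * e') => t Ut.
have [e0 ->] := pe t Ut; have [e'0 ->] := pe' t Ut.
by rewrite !hornerM mulf_neq0 // mulf_div.
Qed.

Lemma rational_onV f : (forall t, U t -> f t != 0) ->
  rational_on U f -> rational_on U (fun t => (f t)^-1).
Proof.
move=> f0 [p [e pe]]; exists e, p => t Ut.
have [e0 ft] := pe t Ut; rewrite ft invf_div; split=> //.
by apply: contraNneq (f0 t Ut) => pt0; rewrite ft pt0 mul0r.
Qed.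

Lemma rational_on_prod (I : Type) (r : seq I) (P : pred I) (f : I -> R[i] -> R[i]) :
  (forall k, rational_on U (f k)) ->
  rational_on U (fun t => \prod_(k <- r | P k) f k t).
Proof.
move=> rf; elim: r => [|k r IHr].
  by apply: eq_rational_on (rational_on_cst 1) => t _; rewrite big_nil.
case Pk: (P k); last by apply: eq_rational_on IHr => t _; rewrite big_cons Pk.
by apply: eq_rational_on (rational_onM (rf k) IHr) => t _; rewrite big_cons Pk.
Qed.

Lemma rational_on_exprz f (z : int) : (forall t, U t -> f t != 0) ->
  rational_on U f -> rational_on U (fun t => f t ^ z).
Proof.
move=> f0 rf.
have rX k : rational_on U (fun t => f t ^+ k).
  elim: k => [|k IHk]; first exact: rational_on_cst.
  by apply: eq_rational_on (rational_onM rf IHk) => t _; rewrite exprS.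
case: z => k; first exact: rX.
apply: rational_onV (rX k.+1) => t Ut.
by rewrite expf_neq0 ?f0.
Qed.

End RationalOn.

(** * Scaling the two subgroups of variables *)

Section Scaling.
Variables (R : realType) (n m r s : nat) (d : split_nef_data n m r s).
Local Notation C := R[i].
Implicit Types (a b : C) (c : 'I_r -> C) (x : 'rV[C]_m).

Definition scale_split a b x : 'rV[C]_m :=
  \row_j (if j \in group01 d then a * x 0 j
          else if j \in group02 d then b * x 0 j else x 0 j).

Definition weight a b (i : 'I_r) : C :=
  (\prod_(k in group01 d) a ^ mult d i k) * \prod_(k in group02 d) b ^ mult d i k.

Definition split_fibre c a b : set 'rV[C]_m :=
  [set x | [/\ in_torus x, forall i, monomial d x i = c i,
               forall l : 'I_s.+1, l != ord0 -> F (group d l) x = 1,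
               F (group01 d) x = a & F (group02 d) x = b]]%classic.

Lemma group02_not01 j : j \in group02 d -> (j \in group01 d) = false.
Proof. by move=> j2; apply: (disjointFl (split_disjoint d)). Qed.

Lemma group0E j : (j \in group d ord0) = (j \in group01 d) || (j \in group02 d).
Proof. by rewrite -(split_cover d) finset.in_setU. Qed.

Lemma group_notin_split (l : 'I_s.+1) j : l != ord0 -> j \in group d l ->
  (j \in group01 d) || (j \in group02 d) = false.
Proof.
move=> l0; rewrite -group0E !inE => /eqP ->.
exact: negbTE.
Qed.

Lemma F_group0 x : F (group d ord0) x = F (group01 d) x + F (group02 d) x.
Proof.
rewrite /F -(@bigU _ _ _ _ [in group01 d] [in group02 d]); last first.
  exact: split_disjoint.
by apply: eq_bigl => j; rewrite group0E inE.
Qed.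

Lemma scale_splitM a b a' b' x :
  scale_split a b (scale_split a' b' x) = scale_split (a * a') (b * b') x.
Proof.
apply/rowP => j; rewrite !mxE.
by case: (j \in group01 d); case: (j \in group02 d); rewrite ?mulrA.
Qed.

Lemma scale_split1 x : scale_split 1 1 x = x.
Proof. by apply/rowP => j; rewrite mxE !mul1r !if_same. Qed.

Lemma scale_splitK a b : a != 0 -> b != 0 ->
  cancel (scale_split a b) (scale_split a^-1 b^-1).
Proof. by move=> a0 b0 x; rewrite scale_splitM !mulVf // scale_split1. Qed.

Lemma scale_splitVK a b : a != 0 -> b != 0 ->
  cancel (scale_split a^-1 b^-1) (scale_split a b).
Proof. by move=> a0 b0 x; rewrite scale_splitM !mulfV // scale_split1. Qed.

Lemma rescaleE x :
  rescale d x = scale_split (F (group01 d) x)^-1 (F (group02 d) x)^-1 x.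
Proof. by apply/rowP => j; rewrite !mxE; do 2?case: ifP; rewrite // mulrC. Qed.

Lemma in_torus_scale a b x :
  a != 0 -> b != 0 -> in_torus x -> in_torus (scale_split a b x).
Proof. by move=> a0 b0 x0 j; rewrite mxE; do 2?case: ifP; rewrite ?mulf_neq0. Qed.

Lemma F01_scale a b x : F (group01 d) (scale_split a b x) = a * F (group01 d) x.
Proof. by rewrite /F mulr_sumr; apply: eq_bigr => j j1; rewrite mxE j1. Qed.

Lemma F02_scale a b x : F (group02 d) (scale_split a b x) = b * F (group02 d) x.
Proof.
by rewrite /F mulr_sumr; apply: eq_bigr => j j2; rewrite mxE group02_not01 // j2.
Qed.

Lemma F_group_scale a b x (l : 'I_s.+1) :
  l != ord0 -> F (group d l) (scale_split a b x) = F (group d l) x.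
Proof.
move=> l0; apply: eq_bigr => j /(group_notin_split l0) /norP[/negbTE j1 /negbTE j2].
by rewrite mxE j1 j2.
Qed.

Lemma monomial_scale a b x i :
  monomial d (scale_split a b x) i = weight a b i * monomial d x i.
Proof.
rewrite /monomial /weight !(big_mkcond (mem (group01 d))) (big_mkcond (mem (group02 d))).
rewrite -!big_split /=; apply: eq_bigr => j _; rewrite mxE.
have [j1|j1] := boolP (j \in group01 d).
  have/negbTE-> : j \notin group02 d by apply: contraL j1 => /group02_not01 ->.
  by rewrite mulr1 expfzMl.
by case: ifP; rewrite !mul1r // expfzMl.
Qed.

Lemma weight_neq0 a b i : a != 0 -> b != 0 -> weight a b i != 0.
Proof.
by move=> a0 b0; rewrite mulf_neq0 //; apply/prodf_neq0 => k _; rewrite expfz_neq0.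
Qed.

Lemma weightM a b a' b' i : weight (a * a') (b * b') i = weight a b i * weight a' b' i.
Proof.
rewrite /weight mulrACA -!big_split /=.
by congr (_ * _); apply: eq_bigr => k _; rewrite expfzMl.
Qed.

Lemma weight1r a i : weight a 1 i = \prod_(k in group01 d) a ^ mult d i k.
Proof. by rewrite /weight [X in _ * X]big1 ?mulr1 // => k _; rewrite exp1rz. Qed.

Lemma weight1l b i : weight 1 b i = \prod_(k in group02 d) b ^ mult d i k.
Proof. by rewrite /weight big1 ?mul1r // => k _; rewrite exp1rz. Qed.

Lemma weightV a b i : weight a^-1 b^-1 i = (weight a b i)^-1.
Proof.
rewrite /weight invfM -!prodfV.
by congr (_ * _); apply: eq_bigr => k _; rewrite exprz_inv invr_expz.
Qed.

Lemma scale_split_fibre a b a' b' c x : a != 0 -> b != 0 ->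
  split_fibre c a' b' x ->
  split_fibre (fun i => weight a b i * c i) (a * a') (b * b') (scale_split a b x).
Proof.
move=> a0 b0 [x0 xc xF x1 x2]; split; rewrite ?F01_scale ?F02_scale ?x1 ?x2 //.
- exact: in_torus_scale.
- by move=> i; rewrite monomial_scale xc.
- by move=> l l0; rewrite F_group_scale ?xF.
Qed.

Lemma eq_split_fibre c c' a b : c =1 c' -> split_fibre c a b = split_fibre c' a b.
Proof.
by move=> cc'; apply/seteqP; split=> x [x0 xc *]; split=> // i; rewrite xc cc'.
Qed.

(** The normalization of a fibre: [rescale] depends on the point through F_{0,1}
    and F_{0,2}, which are constant there, so it is the action of a fixed pair
    and is inverted by the action of the inverse pair. *)
Lemma rescale_split_fibre c a b : a != 0 -> b != 0 ->
  set_bij (split_fibre c a b) (X0_mirror d (fun i => c i / weight a b i)) (rescale d).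
Proof.
move=> a0 b0; have [aV0 bV0] : a^-1 != 0 /\ b^-1 != 0 by rewrite !invr_neq0.
have rescE x : split_fibre c a b x -> rescale d x = scale_split a^-1 b^-1 x.
  by move=> [_ _ _ x1 x2]; rewrite rescaleE x1 x2.
split.
- move=> x Ex; rewrite rescE //; move: (scale_split_fibre aV0 bV0 Ex).
  rewrite !mulVf //; rewrite (@eq_split_fibre _ (fun i => c i / weight a b i)) //.
  by move=> i; rewrite weightV mulrC.
- move=> x y /set_mem Ex /set_mem Ey; rewrite !rescE // => eqxy.
  exact: can_inj (scale_splitVK a0 b0) _ _ eqxy.
- move=> y Ey; have := scale_split_fibre (a' := 1) (b' := 1) a0 b0 Ey.
  rewrite !mulr1 (@eq_split_fibre _ c) => [Ex|i]; last first.
    by rewrite mulrC divfK ?weight_neq0.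
  by exists (scale_split a b y); rewrite // rescE // scale_splitK.
Qed.

(** What remains to be checked for each family: the values of F_{0,1}, of
    F_{0,2} and of the monomials on its fibres. *)
Lemma functional_invariant_split (P : Type) (E : set P) (W : P -> C)
    (coord : P -> 'rV[C]_m) (U : set C) (lam : C -> 'I_r -> C)
    (c : C -> 'I_r -> C) (a b : C -> C) :
  (forall i, rational_on U (c ^~ i)) -> rational_on U a -> rational_on U b ->
  (forall t, U t -> [/\ a t != 0, b t != 0 & forall i, c t i != 0]) ->
  (forall t i, U t -> lam t i = c t i / weight (a t) (b t) i) ->
  (forall t, U t ->
     set_bij (E `&` W @^-1` [set t])%classic (split_fibre (c t) (a t) (b t)) coord) ->
  functional_invariant d E W coord U lam.
Proof.
move=> rc ra rb nz0 lamE fibreE.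
have a0 t : U t -> a t != 0 by case/nz0.
have b0 t : U t -> b t != 0 by case/nz0.
have w0 i t : U t -> weight (a t) (b t) i != 0.
  by move=> Ut; rewrite weight_neq0 ?a0 ?b0.
split=> [i|t Ut].
  apply: (@eq_rational_on _ _ (fun t => c t i / weight (a t) (b t) i)).
    by move=> t Ut; rewrite lamE.
  apply: rational_onM (rc i) _; apply: rational_onV (w0 i) _.
  by apply: rational_onM; apply: rational_on_prod => k; apply: rational_on_exprz.
split=> [i|].
  by have [_ _ c0] := nz0 t Ut; rewrite lamE // mulf_neq0 ?invr_neq0 ?w0.
have -> : lam t = fun i => c t i / weight (a t) (b t) i.
  by apply/funext => i; rewrite lamE.
apply: set_bij_comp (fibreE t Ut) _.
by apply: rescale_split_fibre; [exact: a0 | exact: b0].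
Qed.

End Scaling.

(** * The three functional invariants *)

Section Invariants.
Variables (R : realType) (n m r s : nat) (d : split_nef_data n m r s).
Local Notation C := R[i].
Implicit Types (q : 'I_r -> C).

Lemma functional_invariant_X q : (forall i, q i != 0) ->
  functional_invariant d (X_mirror d q) (F (group02 d)) id (@X_base R) (lambda d q).
Proof.
move=> q0; apply: (@functional_invariant_split _ _ _ _ _ _ _ _ _ _ _ _
  (fun=> q) (fun y => 1 - y) id).
- by move=> i; exact: rational_on_cst.
- by apply: rational_onB; [exact: rational_on_cst | exact: rational_on_id].
- exact: rational_on_id.
- by move=> y [y0 y1]; split=> //; rewrite subr_eq0 eq_sym.
- by [].
- move=> y _; suff -> : (X_mirror d q `&` F (group02 d) @^-1` [set y])%classic =
      split_fibre d q (1 - y) y by exact: (@bij _ _ _ _ idfun).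
  apply/seteqP; split=> x.
    move=> [[x0 xq xF] x2]; split=> //.
    by rewrite -(xF ord0) F_group0 -{}x2 addrK.
  move=> [x0 xq xF x1 x2]; split=> //; split=> // l.
  have [->|/xF //] := eqVneq l ord0.
  by rewrite F_group0 x1 x2 subrK.
Qed.

Lemma functional_invariant_X1 q : (forall i, q i != 0) ->
  functional_invariant d (X1_mirror d q) (F (group02 d)) id (@X1_base R) (lambda1 d q).
Proof.
move=> q0; apply: (@functional_invariant_split _ _ _ _ _ _ _ _ _ _ _ _
  (fun=> q) (fun=> 1) id).
- by move=> i; exact: rational_on_cst.
- exact: rational_on_cst.
- exact: rational_on_id.
- by move=> y y0; rewrite oner_neq0.
- by move=> y i _; rewrite weight1l.
- move=> y _; suff -> : (X1_mirror d q `&` F (group02 d) @^-1` [set y])%classic =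
      split_fibre d q 1 y by exact: (@bij _ _ _ _ idfun).
  by apply/seteqP; split=> x; [move=> [[]] | move=> []].
Qed.

Lemma functional_invariant_X2 q q02 : (forall i, q i != 0) ->
  functional_invariant d (X2_mirror d q q02) snd fst (X2_base q02) (lambda2 d q q02).
Proof.
move=> q0; pose M i : int := - \sum_(k in group02 d) mult d i k.
(* On a fibre y_2 is fixed, so its power moves to the right of the monomial
   equation. *)
apply: (@functional_invariant_split _ _ _ _ _ _ _ _ _ _ _ _
  (fun y i => q i / y ^ M i) (fun y => 1 - q02 / y) (fun=> 1)).
- move=> i; apply: rational_onM; first exact: rational_on_cst.
  apply: rational_onV => [y [y0 _]|]; first by rewrite expfz_neq0.
  by apply: rational_on_exprz; [move=> y [] | exact: rational_on_id].
- apply: rational_onB; first exact: rational_on_cst.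
  apply: rational_onM; first exact: rational_on_cst.
  by apply: rational_onV; [move=> y [] | exact: rational_on_id].
- exact: rational_on_cst.
- move=> y [y0 yq]; split=> [||i]; rewrite ?oner_neq0 //.
    by rewrite subr_eq0 eq_sym; apply: contraNneq yq => /divr1_eq ->.
  by rewrite mulf_neq0 ?invr_neq0 ?expfz_neq0.
- by move=> y i _; rewrite weight1r /lambda2 invfM mulrA.
- move=> y [y0 _]; have yM i : y ^ M i != 0 by rewrite expfz_neq0.
  split.
  + move=> [x y'] [[/= [x0 _] xq xF x1 x2] yy'].
    rewrite /= in yy'; subst y'; split=> // [i|].
      by rewrite -xq mulfK ?yM.
    by rewrite -x1 addrK.
  + by move=> [x t] [x' t'] /set_mem[_ /= ->] /set_mem[_ /= ->] ->.
  + move=> x [x0 xq xF x1 x2]; exists (x, y) => //; split=> //; split=> //=.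
      by move=> i; rewrite xq divfK ?yM.
    by rewrite x1 subrK.
Qed.

End Invariants.

Theorem proposition5p7 (R : realType) (n m r s : nat)
    (d : split_nef_data n m r s) (q q1 q2 : 'I_r -> R[i]) (q02 : R[i])
    (hq : forall i, q i != 0) (hq1 : forall i, q1 i != 0)
    (hq2 : forall i, q2 i != 0) (hq02 : q02 != 0) :
  [/\ functional_invariant d (X_mirror d q) (F (group02 d)) id (@X_base R)
        (lambda d q),
      functional_invariant d (X1_mirror d q1) (F (group02 d)) id (@X1_base R)
        (lambda1 d q1),
      functional_invariant d (X2_mirror d q2 q02) snd fst (X2_base q02)
        (lambda2 d q2 q02) &
      forall y y1 y2 : R[i],
        X_base y -> X1_base y1 -> X2_base q02 y2 ->
        (forall i, q i = q1 i) ->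
        (forall i, q i = q2 i * y2 ^ (\sum_(k in group02 d) mult d i k)) ->
        y = y1 -> y = q02 / y2 ->
        forall i, lambda d q y i / q i =
                  (lambda1 d q1 y1 i / q i) * (lambda2 d q2 q02 y2 i / q i)].
Proof.
split; [exact: functional_invariant_X | exact: functional_invariant_X1
       | exact: functional_invariant_X2 |].
move=> y y1 y2 _ _ _ q1E q2E <- yE i.
have -> : lambda d q y i = q i / (weight d 1 y i * weight d (1 - y) 1 i).
  by rewrite -weightM mul1r mulr1.
have -> : lambda1 d q1 y i = q i / weight d 1 y i by rewrite weight1l q1E.
have -> : lambda2 d q2 q02 y2 i = q i / weight d (1 - y) 1 i.
  by rewrite weight1r /lambda2 -yE -invr_expz invfM invrK q2E mulrA.
have qK w : q i / w / q i = w^-1 by rewrite mulrAC mulfV ?mul1r.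
by rewrite !qK invfM.
Qed.
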